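(* Let $\beta\in \mathrm{Sym}_n(\mathbb Q)$ be positive semi-definite of rank $n-1$, $\ell_j$ a cusp, and $U_{ij}$ one of the finitely many $n$-dimensional subspaces of the form $\mathrm{span}(X)$, $X\in\Omega_{\beta,j}\cap(L^n+h)$. The action of $\Gamma_j$ on $\Omega_{\beta,j}$ induces a free action of $\Gamma_{U_{ij}}\backslash\Gamma_j$ on $\Omega_{\beta,i,j}$, where $\Gamma_{U_{ij}}=N_{U_{ij}}\cap\Gamma_j$ is the subgroup of $\Gamma_j$ acting trivially on $U_{ij}$.
   Context: $V$ is a $\mathbb Q$-vector space of dimension $p+1$ with a non-degenerate symmetric bilinear form $(\,,)$ of signature $(p,1)$; $L\subset V$ is a $\mathbb Z$-lattice of full rank with $L\subset L^{\#}$ (dual lattice); $1\le n\le p$, $h\in(L^{\#})^n$. $G_0(\mathbb R)$ is the identity component of $SO(V)(\mathbb R)$ and $\Gamma$ is a neat subgroup of finite index in the stabilizer of $L$ in $G_0(\mathbb R)$, acting trivially on $L^{\#}/L$; $V$ has nonzero rational isotropic vectors. $\ell_0,\dots,\ell_r$ represent the $\Gamma$-orbits of rational isotropic lines. $N_j$ is the unipotent radical of the parabolic subgroup stabilizing $\ell_j$; it fixes $\ell_j$ pointwise and acts trivially on $\ell_j^\perp/\ell_j$; $\Gamma_j=\Gamma\cap N_j$, and for $U\subset\ell_j^\perp$, $N_U=\{g\in N_j:g|_U=\mathrm{id}\}$. For $X\in V^n$, $(X,X)=((x_i,x_j))$, and $R(X)$ is the radical of $\mathrm{span}(X)$. $\Omega_{\beta,j}=\{X\in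 V^n:\frac12(X,X)=\beta,\ R(X)=\ell_j\}$ and $\Omega_{\beta,i,j}=\{X\in\Omega_{\beta,j}:\mathrm{span}(X)=U_{ij}\}$. *)

(* Defs.v *)
From mathcomp Require Import all_boot all_order all_algebra all_field.
From mathcomp Require Import sesquilinear.
From mathcomp Require Import classical_sets reals topology normedtype.

Set Implicit Arguments.
Unset Strict Implicit.
Unset Printing Implicit Defensive.

Import Order.TTheory GRing.Theory Num.Theory.
Import numFieldNormedType.Exports.

Local Open Scope classical_set_scope.
Local Open Scope ring_scope.

(* Subgroups of the group of invertible elements of a monoid (T, mul, one),
   used both for endomorphisms of V and for square matrices. *)
Section AbstractGroups.
Variables (T : Type) (mul : T -> T -> T) (one : T).

Definition is_subgroup (G : set T) : Prop :=
  [/\ G one,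
      forall x y, G x -> G y -> G (mul x y) &
      forall x, G x -> exists2 y, G y & mul x y = one /\ mul y x = one].

Definition is_normal_subgroup (H G : set T) : Prop :=
  [/\ is_subgroup G, is_subgroup H, H `<=` G &
      forall g g' x, G g -> G g' -> mul g g' = one -> H x ->
        H (mul g (mul x g'))].

Definition is_finite_index (H G : set T) : Prop :=
  [/\ is_subgroup H, H `<=` G &
      exists s : seq T, forall g, G g ->
        exists2 i, (i < size s)%N & exists2 x, H x & g = mul x (nth one s i)].

Definition coset_cls (H : set T) (g : T) : set T := [set mul x g | x in H].

Definition quotient_set (H G : set T) : set (set T) :=
  [set coset_cls H g | g in G].

Definition set_mul (A B : set T) : set T :=
  [set z | exists2 x, A x & exists2 y, B y & z = mul x y].

Definition is_action (S : Type) (G : set T) (Om : set S) (a : T -> S -> S) :=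
  [/\ forall g x, G g -> Om x -> Om (a g x),
      forall x, Om x -> a one x = x &
      forall g g' x, G g -> G g' -> Om x -> a (mul g g') x = a g (a g' x)].

Definition is_free_action (S : Type) (G : set T) (Om : set S)
    (a : T -> S -> S) :=
  is_action G Om a /\ forall g x, G g -> Om x -> a g x = x -> g = one.

End AbstractGroups.

Section Unipotent.
Variables (K : fieldType) (d : nat).

Definition unipotent_mx (A : 'M[K]_d) : Prop :=
  exists k : nat, (A - 1%:M) ^+ k = 0.

(* The largest normal subgroup of P consisting of unipotent elements.  If P is
   the group of points of a linear algebraic group over an algebraically closed
   field of characteristic 0, the Zariski closure of a normal unipotent
   subgroup is again normal and unipotent, hence connected, so that no
   closedness or connectedness condition is needed to obtain R_u(P). *)
Definition unipotent_radical (P : set 'M[K]_d) : set 'M[K]_d :=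
  [set A | exists H : set 'M[K]_d,
     [/\ is_normal_subgroup mulmx 1%:M H P,
         forall B, H B -> unipotent_mx B & H A]].

(* The group generated by the eigenvalues of A is torsion free. *)
Definition neat_mx (A : 'M[K]_d) : Prop :=
  forall (s : seq (K * int)) (k : nat),
    all (fun c => eigenvalue A c.1) s -> (0 < k)%N ->
    (\prod_(c <- s) c.1 ^ c.2) ^+ k = 1 -> \prod_(c <- s) c.1 ^ c.2 = 1.

End Unipotent.

Section QuadraticSpace.
Variables (V : vectType rat) (form : {symmetric V}).

Definition has_signature (r s : nat) : Prop :=
  exists e : (\dim {:V}).-tuple V,
    [/\ basis_of {:V} e,
        forall i j, i != j -> form (tnth e i) (tnth e j) = 0,
        count (fun v => 0 < form v v) e = r &
        count (fun v => form v v < 0) e = s].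

Definition gram m (X : m.-tuple V) : 'M[rat]_m :=
  \matrix_(i, j) form (tnth X i) (tnth X j).

Definition isotropic_line (l : {vspace V}) : Prop :=
  \dim l = 1%N /\ {in l, forall x, form x x = 0}.

Definition radical (U : {vspace V}) : {vspace V} := (U :&: orthov form U)%VS.

(* Extension of scalars from rat to K, in coordinates with respect to a fixed
   basis of V.  Matrices act on row vectors, so g |-> pts K g reverses
   products; this affects none of the notions below. *)
Definition pts (K : numFieldType) (g : 'End(V)) : 'M[K]_(\dim {:V}) :=
  map_mx ratr (passmx.mxof (vbasis {:V}) (vbasis {:V}) g).

Definition gramK (K : numFieldType) : 'M[K]_(\dim {:V}) :=
  map_mx ratr (gram (vbasis {:V})).

(* A matrix whose row space is the coordinate form of U (x) K. *)
Definition vspaceK (K : numFieldType) (U : {vspace V}) : 'M[K]_(\dim {:V}) :=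
  map_mx ratr (passmx.msof (vbasis {:V}) U).

Definition SO (K : numFieldType) : set 'M[K]_(\dim {:V}) :=
  [set A | A *m gramK K *m A^T = gramK K /\ \det A = 1].

Definition SO0 (R : realType) : set 'M[R]_(\dim {:V}) :=
  connected_component (@SO R) 1%:M.

Definition parabolic (K : numFieldType) (l : {vspace V}) :
    set 'M[K]_(\dim {:V}) :=
  [set A | @SO K A /\ stablemx (vspaceK K l) A].

(* Rational points of the unipotent radical of the stabilizer of l in SO(V). *)
Definition unip (l : {vspace V}) : set 'End(V) :=
  [set g | unipotent_radical (@parabolic algC l) (pts algC g)].

Definition is_lattice (L : set V) : Prop :=
  exists2 e : (\dim {:V}).-tuple V, basis_of {:V} e & L = inIntSpan e.

Definition dual_lattice (L : set V) : set V :=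
  [set x | forall y, L y -> form x y \is a Num.int].

(* An element of SO(V)(R) preserving L is rational, since L spans V. *)
Definition lattice_stab (R : realType) (L : set V) : set 'End(V) :=
  [set g | @SO0 R (pts R g) /\ [set g x | x in L] = L].

Definition is_neat (Gam : set 'End(V)) : Prop :=
  forall g, Gam g -> neat_mx (pts algC g).

Definition trivial_on_discriminant (L : set V) (Gam : set 'End(V)) : Prop :=
  forall g x, Gam g -> dual_lattice L x -> L (g x - x).

Definition cusp_representatives (Gam : set 'End(V)) (r : nat)
    (ell : 'I_r.+1 -> {vspace V}) : Prop :=
  (forall j, isotropic_line (ell j)) /\
  forall l, isotropic_line l ->
    exists! j, exists2 g, Gam g & (g @: ell j)%VS = l.

Definition Omega n (beta : 'M[rat]_n) (l : {vspace V}) : set (n.-tuple V) :=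
  [set X | 2^-1 *: gram X = beta /\ radical <<X>> = l].

Definition Omega_span n (beta : 'M[rat]_n) (l U : {vspace V}) :
    set (n.-tuple V) :=
  [set X | Omega beta l X /\ <<X>>%VS = U].

Definition lattice_coset n (L : set V) (h : n.-tuple V) : set (n.-tuple V) :=
  [set X | forall i, L (tnth X i - tnth h i)].

Definition cusp_subspaces n (beta : 'M[rat]_n) (l : {vspace V})
    (L : set V) (h : n.-tuple V) : set {vspace V} :=
  [set U | \dim U = n /\
           exists2 X, (Omega beta l `&` lattice_coset L h) X & <<X>>%VS = U].

Definition fix_subgroup (G : set 'End(V)) (U : {vspace V}) : set 'End(V) :=
  [set g | G g /\ {in U, forall x, g x = x}].

Definition act_tuple n (g : 'End(V)) (X : n.-tuple V) : n.-tuple V :=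
  map_tuple g X.

End QuadraticSpace.

Definition psd_mx n (beta : 'M[rat]_n) : Prop :=
  beta^T = beta /\ forall x : 'rV[rat]_n, 0 <= (x *m beta *m x^T) 0 0.

(* Main.v *)
(** The unipotent radical of the stabilizer of the isotropic line [l] is the group
    of isometries acting trivially on [l] and on [l^\perp / l].  Such isometries
    form a normal unipotent subgroup over any field.  Conversely, a rational
    isometry that is unipotent and stabilizes [l] acts on [l^\perp / l] as a
    unipotent isometry of a definite form, hence trivially; only rational
    points matter, so that no structure theory of algebraic groups is needed.
    Since [l <= U <= l^\perp], the group [Gam_j] moves the vectors of [U] by
    elements of [l] and so preserves [U]; an element fixing a tuple that spans
    [U] fixes [U] pointwise, which gives freeness. *)
Require Import Defs.
From mathcomp Require Import all_boot all_order all_algebra all_field.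
From mathcomp Require Import sesquilinear.
From mathcomp Require Import classical_sets reals topology normedtype.

Set Implicit Arguments.
Unset Strict Implicit.
Unset Printing Implicit Defensive.

Import Order.TTheory GRing.Theory Num.Theory.
Local Open Scope classical_set_scope.
Local Open Scope ring_scope.

Section MatrixStabilizer.
Variables (K : fieldType) (d : nat) (G M : 'M[K]_d).
Implicit Types A B : 'M[K]_d.

Definition SO_stab : set 'M[K]_d :=
  [set A | (A *m G *m A^T = G /\ \det A = 1) /\ stablemx M A].

(* If the rows of [M] span [l], then the rows of [kermx (G *m M^T)] span [l^\perp]. *)
Definition SO_stab_trivial : set 'M[K]_d :=
  [set A | [/\ A *m G *m A^T = G /\ \det A = 1, M *m A = M &
               (kermx (G *m M^T) *m (A - 1%:M) <= M)%MS]].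

Lemma SO_stab_unit A : SO_stab A -> A \in unitmx.
Proof. by case=> -[_ dA] _; rewrite unitmxE dA unitr1. Qed.

Lemma stablemx_invmx A : A \in unitmx -> stablemx M A -> stablemx M (invmx A).
Proof.
move=> uA sA; have : (M *m A == M)%MS.
  by rewrite -(mxrank_leqif_eq sA) mxrankMfree // row_free_unit.
case/andP=> _ MA; rewrite -[X in (_ <= X)%MS](mulmxK uA).
exact: submxMr.
Qed.

Lemma SO_stab_subgroup : is_subgroup mulmx 1%:M SO_stab.
Proof.
split=> [|A B [[isoA dA] sA] [[isoB dB] sB]|A PA].
- by split; [rewrite mul1mx trmx1 mulmx1 det1 | exact: stablemxC].
- split; last exact: stablemxM.
  by rewrite trmx_mul det_mulmx dA dB mul1r -!mulmxA
    (mulmxA G) (mulmxA B) (mulmxA B G) isoB mulmxA isoA.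
- have uA := SO_stab_unit PA; case: PA => -[isoA dA] sA.
  exists (invmx A); last by rewrite mulmxV ?mulVmx.
  split; last exact: stablemx_invmx.
  split; last by rewrite det_inv dA invr1.
  rewrite -[in LHS]isoA trmx_inv mulmxA mulmxA mulVmx // mul1mx.
  by rewrite mulmxK // unitmx_tr.
Qed.

Lemma SO_stab_trivial_sub : SO_stab_trivial `<=` SO_stab.
Proof. by move=> A [isoA MA _]; split; rewrite ?MA. Qed.

Lemma SO_stab_kermx A : SO_stab A -> stablemx (kermx (G *m M^T)) A.
Proof.
move=> PA; have [_ _ inv] := SO_stab_subgroup.
have [B [_ /submxP[C MB]] [AB BA]] := inv _ PA; case: PA => -[isoA _] _.
apply/sub_kermxP; have := mulmx_ker (G *m M^T); move: (kermx _) => k kE.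
have -> : M^T = A^T *m (M *m B)^T by rewrite trmx_mul mulmxA -trmx_mul BA trmx1 mul1mx.
rewrite MB trmx_mul !mulmxA -2!(mulmxA k) isoA.
by rewrite -(mulmxA _ G) kE mul0mx.
Qed.

(* An isometry fixing [l] pointwise moves every vector by an
   element of [l^\perp], so [A - 1] maps [V] to [l^\perp], [l^\perp] to [l]
   and [l] to [0]. *)
Lemma SO_stab_trivial_unipotent A : SO_stab_trivial A -> unipotent_mx A.
Proof.
case=> -[isoA _] MA /submxP[C kA]; exists 3.
set k := kermx _ in kA *.
have /submxP[D AD] : (A - 1%:M <= kermx (G *m M^T))%MS.
  apply/sub_kermxP; rewrite mulmxBl mul1mx -{1}MA trmx_mul !mulmxA isoA.
  by rewrite subrr.
rewrite !exprS mulr1 -!mulmxE [X in X *m (_ *m _)]AD mulmxA -(mulmxA D) kA.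
by rewrite -mulmxA -mulmxA mulmxBr MA mulmx1 subrr !mulmx0.
Qed.

Lemma SO_stab_trivial_normal : is_normal_subgroup mulmx 1%:M SO_stab_trivial SO_stab.
Proof.
have [P1 PM PV] := SO_stab_subgroup; have NP := SO_stab_trivial_sub.
split=> //.
- split=> [|A B NA NB|A NA].
  + by case: P1 => ? _; split; rewrite // ?mulmx1 // subrr mulmx0 sub0mx.
  + have [isoAB _] := PM _ _ (NP _ NA) (NP _ NB).
    have [_ MA kA] := NA; have [_ MB kB] := NB.
    split; rewrite // ?mulmxA ?MA //.
    have -> : A *m B - 1%:M = A *m (B - 1%:M) + (A - 1%:M).
      by rewrite mulmxBr mulmx1 addrA subrK.
    rewrite mulmxDr addmx_sub // mulmxA (submx_trans _ kB) // submxMr //.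
    exact: SO_stab_kermx (NP _ NA).
  + have [B PB [AB BA]] := PV _ (NP _ NA); exists B => //.
    have [_ MA kA] := NA; have MB : M *m B = M by rewrite -{1}MA -mulmxA AB mulmx1.
    split; [by case: PB | by [] | ].
    have -> : B - 1%:M = B *m (1%:M - A) by rewrite mulmxBr BA mulmx1.
    rewrite -opprB mulmxN mulmxN eqmx_opp mulmxA (submx_trans _ kA) // submxMr //.
    exact: SO_stab_kermx.
- move=> B B' A PB PB' BB' NA; have [_ MA kA] := NA.
  have [isoX _] := PM _ _ PB (PM _ _ (NP _ NA) PB').
  split=> //.
    by case: PB => _ /submxP[C MB]; rewrite mulmxA MB !mulmxA -(mulmxA C) MA -MB
      -mulmxA BB' mulmx1.
  have -> : B *m (A *m B') - 1%:M = B *m (A - 1%:M) *m B'.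
    by rewrite mulmxBr mulmx1 mulmxBl BB' mulmxA.
  case: PB' => _ sB'; rewrite !mulmxA (submx_trans _ sB') // submxMr //.
  by rewrite (submx_trans _ kA) // submxMr // SO_stab_kermx.
Qed.

Lemma SO_stab_trivial_radical : SO_stab_trivial `<=` unipotent_radical SO_stab.
Proof.
move=> A NA; exists SO_stab_trivial; split=> //.
  exact: SO_stab_trivial_normal.
exact: SO_stab_trivial_unipotent.
Qed.

End MatrixStabilizer.

Section Lorentzian.
Variables (V : vectType rat) (form : {symmetric V}).
Implicit Types (u v w x y : V) (l U : {vspace V}) (g : 'End(V)).

Lemma form_sym u v : form u v = form v u.
Proof. by rewrite hermC expr0 mul1r. Qed.

Lemma form_tuple_sum n (t : n.-tuple V) (c c' : 'I_n -> rat) :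
  form (\sum_i c i *: t`_i) (\sum_i c' i *: t`_i) =
  \sum_i \sum_j c i * c' j * form t`_i t`_j.
Proof.
rewrite linear_sumlz; apply: eq_bigr => i _; rewrite linear_sumr.
apply: eq_bigr => k _.
by rewrite linearZl_LR /= linearZr_LR /= mulrA.
Qed.

Lemma form_orthogonal_coord n (e : n.-tuple V) (i0 : 'I_n) v :
  basis_of {:V} e ->
  (forall i j, i != j -> form (tnth e i) (tnth e j) = 0) ->
  (forall i, i != i0 -> 0 < form (tnth e i) (tnth e i)) ->
  coord e i0 v = 0 -> form v v = 0 -> v = 0.
Proof.
move=> eB eO eP v0.
have -> : form v v = \sum_i \sum_j coord e i v * coord e j v * form e`_i e`_j.
  by rewrite -form_tuple_sum -(coord_basis eB (memvf v)).
rewrite (eq_bigr (fun i => coord e i v ^+ 2 * form (tnth e i) (tnth e i))); last first.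
  move=> i _; rewrite (bigD1 i) //= big1 ?addr0; last first.
    by move=> k ki; rewrite -!tnth_nth eO 1?eq_sym // mulr0.
  by rewrite -!tnth_nth.
have pos i : true -> 0 <= coord e i v ^+ 2 * form (tnth e i) (tnth e i).
  case: (eqVneq i i0) => [-> _|/eP/ltW ? _]; first by rewrite v0 expr0n mul0r.
  by rewrite mulr_ge0 // sqr_ge0.
move=> sum0; rewrite (coord_basis eB (memvf v)) big1 // => i _.
case: (eqVneq i i0) => [->|/eP ei]; first by rewrite v0 scale0r.
have /(_ i isT)/eqP := psumr_eq0P pos sum0.
by rewrite mulf_eq0 sqrf_eq0 (gt_eqF ei) orbF => /eqP->; rewrite scale0r.
Qed.

Lemma isotropic_lineE l : isotropic_line form l ->
  exists v, [/\ v != 0, form v v = 0 & l = <[v]>%VS].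
Proof.
case=> dl l0; exists (vpick l).
have vl := memv_pick l; have v0 : vpick l != 0 by rewrite vpick0 -dimv_eq0 dl.
split; [by [] | exact: l0 | apply/eqP].
by rewrite eq_sym eqEdim -memvE vl dim_vline v0 dl.
Qed.

(* With respect to an orthogonal basis having a single vector [e_i0] of
   nonpositive square, an isotropic vector has nonzero [i0]-th coordinate, so
   modulo [l] every vector may be assumed to lie in the definite hyperplane
   spanned by the other basis vectors. *)
Lemma orthov_anisotropic p l x :
  has_signature form p 1 -> \dim {:V} = p.+1 -> isotropic_line form l ->
  x \in orthov form l -> form x x = 0 -> x \in l.
Proof.
move=> [e [eB eO eP _]] dV /isotropic_lineE[v [v0 vv ->]] xv xx.
have /cards1P[i0 Ei0] : #|[set i | ~~ (0 < form (tnth e i) (tnth e i))]%SET| == 1%N.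
  have : (p + count (predC (fun w => (0 < form w w)%R)) e)%N = (p + 1)%N.
    by rewrite -{1}eP count_predC size_tuple dV addn1.
  move/addnI => cnt; apply/eqP; rewrite -sum1_card -[RHS]cnt -sum1_count [RHS]big_tuple.
  by apply: eq_bigl => i; rewrite inE.
have ePos i : i != i0 -> 0 < form (tnth e i) (tnth e i).
  apply: contraNT => ei; move/setP: Ei0 => /(_ i).
  by rewrite !inE ei => /esym.
have crd0 := form_orthogonal_coord eB eO ePos.
have vi0 : coord e i0 v != 0 by apply: contraNneq v0 => /crd0 ->.
move: xv; rewrite mem_orthov1 => /eqP xv.
pose a := coord e i0 x / coord e i0 v.
suff /eqP : x - a *: v = 0 by rewrite subr_eq0 => /eqP->; rewrite memvZ // memv_line.
apply: crd0; first by rewrite linearB linearZ /= divfK ?subrr.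
rewrite linearBl !linearB /= !linearZl_LR !linearZr_LR /= (form_sym v x) xv xx vv.
by rewrite !mulr0 !subr0.
Qed.

Lemma isometry_unipotent_trivial p l g k :
  has_signature form p 1 -> \dim {:V} = p.+1 -> isotropic_line form l ->
  (forall u v, form (g u) (g v) = form u v) ->
  (forall v, v \in l -> g v \in l) ->
  (forall v, iter k (fun w => g w - w) v = 0) ->
  {in l, forall v, g v = v} /\
  {in orthov form l, forall v, g v - v \in l}.
Proof.
move=> sg dV il iso gl nil; have [dl l0] := il.
have il0 := orthov_anisotropic sg dV il.
have [D DE] : exists D : V -> V, forall w, D w = g w - w by exists (fun w => g w - w).
have {}nil v : iter k D v = 0 by rewrite (eq_iter DE) nil.
have gv v : v \in l -> g v = v.
  have [w [w0 _ lE]] := isotropic_lineE il.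
  have /vlineP[c gw] : g w \in <[w]>%VS by rewrite -lE gl // lE memv_line.
  have iterD i : iter i D w = (c - 1) ^+ i *: w.
    elim: i => [|i IH]; first by rewrite scale1r.
    by rewrite iterS IH DE linearZ /= gw -scalerBr -{2}[w]scale1r -scalerBl scalerA -exprSr.
  have /eqP := nil w; rewrite iterD scaler_eq0 (negPf w0) orbF expf_eq0.
  case/andP=> _; rewrite subr_eq0 => /eqP c1.
  by rewrite lE => /vlineP[a ->]; rewrite linearZ /= gw c1 scale1r.
split=> // x; rewrite -DE; have orthD y : y \in orthov form l -> D y \in orthov form l.
  move=> /mem_orthovP yl; apply/mem_orthovP => v vl.
  by rewrite DE linearBl /= -{1}(gv v vl) iso subrr.
have DD y : y \in orthov form l -> D (D y) \in l -> D y \in l.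
  move=> yl DDl; apply: il0; first exact: orthD.
  have := iso y (D y); have gE z : g z = z + D z by rewrite DE addrC subrK.
  have oDD z : z \in orthov form l -> form z (D (D y)) = 0.
    by move/mem_orthovP; apply.
  rewrite (gE (D y)) (gE y) linearDr !linearDl /= !oDD ?orthD // !addr0 => /eqP.
  by rewrite addrC -subr_eq0 addrK => /eqP.
have orth_iter i y : y \in orthov form l -> iter i D y \in orthov form l.
  by elim: i => // i IH /IH/orthD.
have key i y : y \in orthov form l -> iter i.+1 D y \in l -> D y \in l.
  by elim: i => // i IH yl /(DD _ (orth_iter i _ yl)); apply: IH.
move=> xl; apply: (key k) => //.
by rewrite iterSr nil mem0v.
Qed.

End Lorentzian.

Section Coordinates.
Import passmx.
Variables (V : vectType rat) (form : {symmetric V}).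
Implicit Types (u v w x y : V) (l U : {vspace V}) (g : 'End(V)).
Local Notation e := (vbasis {:V}).
Local Notation rV := (rVof e).
Local Notation eB := (vbasisP {:V}).

Lemma form_rVof u v : form u v = (rV u *m gram form e *m (rV v)^T) 0 0.
Proof.
rewrite [u in LHS](coord_vbasis (memvf u)) [v in LHS](coord_vbasis (memvf v)).
rewrite form_tuple_sum exchange_big mxE; apply: eq_bigr => i _.
rewrite !mxE mulr_suml; apply: eq_bigr => k _.
by rewrite !mxE -!tnth_nth mulrAC.
Qed.

Lemma mem_orthov_rVof l u :
  (u \in orthov form l) = (rV u *m (gram form e *m (msof e l)^T) == 0).
Proof.
have msofE v : v \in l -> rV v *m msof e l = rV v.
  by move=> vl; rewrite -(rVof_app _ eB) projv_id.
apply/mem_orthovP/eqP => [ul|ul v vl]; last first.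
  by rewrite form_rVof -[rV v]msofE // trmx_mul !mulmxA -(mulmxA (rV u)) ul mul0mx mxE.
apply/rowP => k; rewrite mulmxA [RHS]mxE.
have lk : vecof e (row k (msof e l)) \in l.
  by rewrite (mem_vecof eB) row_sub.
rewrite -[RHS](ul _ lk) form_rVof (vecofK eB) !mxE.
by apply: eq_bigr => i _; rewrite !mxE.
Qed.

Lemma pts_comp (K : numFieldType) g g' : pts K (g \o g')%VF = pts K g' *m pts K g.
Proof. by rewrite /pts (mxof_comp _ _ eB) map_mxM. Qed.

Lemma pts_id (K : numFieldType) : pts K (\1%VF : 'End(V)) = 1%:M.
Proof. by rewrite /pts mxof1 ?map_mx1 // (basis_free eB). Qed.

Lemma SO_isometry (K : numFieldType) g :
  SO form (pts K g) -> forall u v, form (g u) (g v) = form u v.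
Proof.
case; rewrite /pts /gramK map_trmx -!map_mxM => /map_mx_inj isoG _ u v.
by rewrite !form_rVof !(rVof_app _ eB) trmx_mul !mulmxA -(mulmxA (rV u)) -(mulmxA (rV u))
  isoG.
Qed.

Lemma stablemx_pts (K : numFieldType) l g :
  stablemx (vspaceK K l) (pts K g) -> forall v, v \in l -> g v \in l.
Proof.
rewrite /pts /vspaceK -map_mxM map_submx => sl v vl.
rewrite -[g v](rVofK eB) (mem_vecof eB) (rVof_app _ eB).
apply: submx_trans sl; apply: submxMr.
by rewrite -(mem_vecof eB) (rVofK eB).
Qed.

Lemma unipotent_pts (K : numFieldType) g :
  unipotent_mx (pts K g) -> exists k, forall v, iter k (fun w => g w - w) v = 0.
Proof.
case=> k gk; exists k => v; apply/eqP; rewrite -(rVof_eq0 eB).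
rewrite -(map_mx_eq0 (ratr : {rmorphism rat -> K})).
suff -> : map_mx ratr (rV (iter k (fun w => g w - w) v)) =
  map_mx ratr (rV v) *m (pts K g - 1%:M) ^+ k by rewrite gk mulmx0.
elim: k {gk} => [|k IH]; first by rewrite mulmx1.
rewrite iterS exprSr -mulmxE mulmxA -IH mulmxBr mulmx1 linearB map_mxB.
by rewrite /= (rVof_app _ eB) map_mxM.
Qed.

Lemma pts_SO_stab_trivial (K : numFieldType) l g :
  SO form (pts K g) -> {in l, forall v, g v = v} ->
  {in orthov form l, forall v, g v - v \in l} ->
  SO_stab_trivial (gramK form K) (vspaceK K l) (pts K g).
Proof.
move=> isog gl gorth; split=> //.
  rewrite /vspaceK /pts -map_mxM -(mxof_comp _ _ eB); congr (map_mx _ (mxof _ _ _)).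
  by apply/lfunP => v; rewrite comp_lfunE gl ?memv_proj.
rewrite /vspaceK /pts /gramK map_trmx -map_mxM -map_kermx
  -(map_mx1 (ratr : {rmorphism rat -> K})) -map_mxB -map_mxM.
rewrite map_submx; apply/row_subP => i; rewrite row_mul.
have := row_sub i (kermx (gram form e *m (msof e l)^T)).
rewrite -[row i _](vecofK eB) => /sub_kermxP/eqP.
rewrite -mem_orthov_rVof => /gorth.
rewrite -[_ - _](rVofK eB) (mem_vecof eB) linearB /= (rVof_app _ eB).
by rewrite mulmxBr mulmx1.
Qed.

End Coordinates.

Section QuotientAction.
Variables (T : choiceType) (S : Type) (mul : T -> T -> T) (one : T).
Hypotheses (mulA : associative mul) (mul1 : left_id one mul) (mule1 : right_id one mul).
Variables (H G : set T).
Hypothesis HG : is_normal_subgroup mul one H G.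

Lemma mem_coset_cls g : coset_cls mul H g g.
Proof. by case: HG => _ [H1 _ _] _ _; exists one. Qed.

Lemma coset_cls_mem h : H h -> coset_cls mul H h = H.
Proof.
case: HG => _ [_ HM HV] _ _ Hh; apply/seteqP; split=> [_ [x Hx <-]|x Hx].
  exact: HM.
have [y Hy [hy yh]] := HV _ Hh; exists (mul x y); first exact: HM.
by rewrite -mulA yh mule1.
Qed.

Lemma set_mul_coset_cls g g' : G g -> G g' ->
  set_mul mul (coset_cls mul H g) (coset_cls mul H g') = coset_cls mul H (mul g g').
Proof.
case: (HG) => -[_ _ GV] [_ HM _] _ HJ Gg Gg'; apply/seteqP; split=> [z|_ [x Hx <-]].
  case=> _ [x Hx <-] [_ [y Hy <-] ->]; have [k Gk [gk kg]] := GV _ Gg.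
  exists (mul x (mul g (mul y k))); first by apply: HM => //; apply: HJ.
  by rewrite -!mulA; do 3!congr (mul _ _); rewrite mulA kg mul1.
exists (mul x g); first by exists x.
by exists g'; [exact: mem_coset_cls | rewrite mulA].
Qed.

Lemma quotient_free_action (Om : set S) (act : T -> S -> S) :
  is_action mul one G Om act ->
  (forall g x, G g -> Om x -> (act g x = x <-> H g)) ->
  exists a : set T -> S -> S,
    (forall g x, G g -> Om x -> a (coset_cls mul H g) x = act g x) /\
    is_free_action (set_mul mul) H (quotient_set mul H G) Om a.
Proof.
case=> actO act1 actM stab; have [[G1 GM GV] [H1 HM HV] sHG _] := HG.
pose a C x := act (xget one C) x.
have aE g x : G g -> Om x -> a (coset_cls mul H g) x = act g x.
  move=> Gg Ox; rewrite /a.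
  have [h Hh <-] := xgetPex one (ex_intro _ g (mem_coset_cls g)).
  have Gh := sHG _ Hh; rewrite actM //; exact: (stab h (act g x) Gh (actO g x Gg Ox)).2.
exists a; split=> //; split; first split.
- by move=> _ x [g Gg <-] Ox; rewrite aE //; apply: actO.
- by move=> x Ox; rewrite -[H](coset_cls_mem H1) aE // act1.
- move=> _ _ x [g Gg <-] [g' Gg' <-] Ox.
  by rewrite set_mul_coset_cls // !aE ?actM //; [exact: actO | exact: GM].
- move=> _ x [g Gg <-] Ox; rewrite aE // => gx.
  by apply: coset_cls_mem; apply: (stab g x Gg Ox).1.
Qed.

End QuotientAction.

Section UnipotentRadical.
Variables (V : vectType rat) (form : {symmetric V}) (p : nat) (l : {vspace V}).
Hypotheses (sig : has_signature form p 1) (dimV : \dim {:V} = p.+1)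
  (iso_l : isotropic_line form l).
Implicit Types (g : 'End(V)).

Lemma unip_trivial g : unip form l g ->
  [/\ forall u v, form (g u) (g v) = form u v,
      {in l, forall v, g v = v} &
      {in orthov form l, forall v, g v - v \in l}].
Proof.
case=> H [[_ _ HP _] Hu Hg]; have [isog sg] := HP _ Hg.
have [k nil] := unipotent_pts (Hu _ Hg); have iso := SO_isometry isog.
by have [? ?] := isometry_unipotent_trivial sig dimV iso_l iso (stablemx_pts sg) nil.
Qed.

Lemma unipE g : unip form l g <->
  SO_stab_trivial (gramK form algC) (vspaceK algC l) (pts algC g).
Proof.
split; last exact: SO_stab_trivial_radical.
move=> Ng; have [_ gl gorth] := unip_trivial Ng.
case: Ng => H [[_ _ HP _] _ /HP[isog _]].
exact: pts_SO_stab_trivial.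
Qed.

Lemma unip_subgroup : [/\ unip form l \1%VF,
  forall g g', unip form l g -> unip form l g' -> unip form l (g \o g')%VF &
  forall g g', unip form l g -> (g \o g')%VF = \1%VF -> unip form l g'].
Proof.
have [_ [N1 NM NV] _ _] := SO_stab_trivial_normal (gramK form algC) (vspaceK algC l).
split=> [|g g' /unipE Ng /unipE Ng'|g g' /unipE Ng gg']; apply/unipE.
- by rewrite pts_id.
- by rewrite pts_comp; apply: NM.
- have [B NB [gB Bg]] := NV _ Ng.
  suff -> : pts algC g' = B by [].
  by rewrite -[LHS]mulmx1 -gB mulmxA -pts_comp gg' pts_id mul1mx.
Qed.

End UnipotentRadical.

Section Tuples.
Variables (V : vectType rat) (form : {symmetric V}).
Implicit Types (g : 'End(V)) (U l : {vspace V}).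

Lemma span_act_tuple n g (X : n.-tuple V) : <<act_tuple g X>>%VS = (g @: <<X>>)%VS.
Proof. by rewrite limg_span. Qed.

Lemma radical_limg g U : (forall u v, form (g u) (g v) = form u v) ->
  radical form (g @: U) = (g @: radical form U)%VS.
Proof.
move=> iso; apply/vspaceP => x; rewrite memv_cap; apply/andP/memv_imgP.
  case=> /memv_imgP[u uU ->] /mem_orthovP gu; exists u => //.
  rewrite memv_cap uU; apply/mem_orthovP => v vU.
  by rewrite -iso gu // memv_img.
case=> u; rewrite memv_cap => /andP[uU /mem_orthovP uo] ->.
split; first exact: memv_img.
by apply/mem_orthovP => _ /memv_imgP[v vU ->]; rewrite iso uo.
Qed.

Lemma Omega_act_tuple n (beta : 'M[rat]_n) l g (X : n.-tuple V) :
  (forall u v, form (g u) (g v) = form u v) -> {in l, forall v, g v = v} ->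
  Omega form beta l X -> Omega form beta l (act_tuple g X).
Proof.
move=> iso gl [gX rX]; split.
  by rewrite -gX; congr (_ *: _); apply/matrixP => i j; rewrite !mxE !tnth_map iso.
rewrite span_act_tuple radical_limg // rX -[RHS]lim1g.
by apply: eq_in_limg => v vl; rewrite gl // id_lfunE.
Qed.

Lemma act_tuple_comp n g g' (X : n.-tuple V) :
  act_tuple (g \o g')%VF X = act_tuple g (act_tuple g' X).
Proof. by apply: eq_from_tnth => i; rewrite !tnth_map comp_lfunE. Qed.

Lemma act_tuple_id n (X : n.-tuple V) : act_tuple \1%VF X = X.
Proof. by apply: eq_from_tnth => i; rewrite !tnth_map id_lfunE. Qed.

Lemma act_tuple_fixP n g (X : n.-tuple V) :
  act_tuple g X = X <-> {in <<X>>%VS, forall x, g x = x}.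
Proof.
split=> [gX x xX|gX].
  rewrite (coord_span xX) linear_sum; apply: eq_bigr => i _.
  by rewrite linearZ /=; congr (_ *: _); rewrite -tnth_nth -[in RHS]gX tnth_map.
by apply: eq_from_tnth => i; rewrite tnth_map gX // (memv_span (mem_tnth i X)).
Qed.

End Tuples.

Theorem lemma3p3 (R : realType) (p : nat) (V : vectType rat)
    (form : {symmetric V}) (L : set V) (n : nat) (h : n.-tuple V)
    (Gam : set 'End(V)) (r : nat) (ell : 'I_r.+1 -> {vspace V})
    (beta : 'M[rat]_n) (j : 'I_r.+1) (U : {vspace V}) :
  \dim {:V} = p.+1 ->
  nondegenerate form ->
  has_signature form p 1 ->
  is_lattice L ->
  L `<=` dual_lattice form L ->
  (1 <= n)%N -> (n <= p)%N ->
  (forall i, dual_lattice form L (tnth h i)) ->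
  is_finite_index (@comp_lfun _ V V V) \1%VF Gam (lattice_stab form R L) ->
  is_neat Gam ->
  trivial_on_discriminant form L Gam ->
  (exists2 v : V, v != 0 & form v v = 0) ->
  cusp_representatives form Gam ell ->
  psd_mx beta ->
  \rank beta = n.-1 ->
  cusp_subspaces form beta (ell j) L h U ->
  let N := unip form (ell j) in
  let Gam_j := Gam `&` N in
  let Gam_U := fix_subgroup N U `&` Gam_j in
  let mul := @comp_lfun _ V V V in
  [/\ is_action mul \1%VF Gam_j (Omega form beta (ell j)) (@act_tuple V n),
      is_normal_subgroup mul \1%VF Gam_U Gam_j &
      exists a : set 'End(V) -> n.-tuple V -> n.-tuple V,
        (forall g X, Gam_j g -> Omega_span form beta (ell j) U X ->
           a (coset_cls mul Gam_U g) X = act_tuple g X) /\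
        is_free_action (set_mul mul) Gam_U (quotient_set mul Gam_U Gam_j)
          (Omega_span form beta (ell j) U) a].
Proof.
move=> dV _ sig _ _ _ _ _ [[Gam1 GamM GamV] _ _] _ _ _ [iso_ell _] _ _.
case=> _ [X0 [[_ rX0] _] X0U] N Gam_j Gam_U mul.
have rU : radical form U = ell j by rewrite -X0U.
have [N1 NM NV] := unip_subgroup sig dV (iso_ell j).
have trivN := unip_trivial sig dV (iso_ell j).
have act : is_action mul \1%VF Gam_j (Omega form beta (ell j)) (@act_tuple V n).
  split=> [g X [_ /trivN[iso gl _]]|X _|g g' X _ _ _].
  - exact: Omega_act_tuple.
  - exact: act_tuple_id.
  - exact: act_tuple_comp.
have stabU g v : N g -> v \in U -> g v \in U.
  move=> /trivN[_ gl gorth] vU; rewrite -[g v](subrK v) memvD //.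
  have lU : (ell j <= U)%VS by rewrite -rU capvSl.
  apply: (subvP lU); apply: gorth; apply/mem_orthovP => w.
  by rewrite -rU memv_cap => /andP[_ /mem_orthovP wU]; rewrite form_sym wU.
have Gj : is_subgroup mul \1%VF Gam_j.
  split=> [//|g g' [Gg Ng] [Gg' Ng']|g [Gg Ng]].
    by split; [exact: GamM | exact: NM].
  have [g' Gg' [gg' g'g]] := GamV _ Gg; exists g' => //.
  by split=> //; apply: NV gg'.
have GU_normal : is_normal_subgroup mul \1%VF Gam_U Gam_j.
  have [G1 GM GV] := Gj; split=> //; first split.
  - by do 2!split=> //; move=> x _; rewrite id_lfunE.
  - move=> g g' [[Ng gU] Gg] [[Ng' gU'] Gg']; split; last exact: GM.
    by split; [exact: NM | move=> x xU; rewrite comp_lfunE gU' ?gU].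
  - move=> g [[Ng gU] Gg]; have [g' Gg' [gg' g'g]] := GV _ Gg; exists g' => //.
    split=> //; split; first by case: Gg'.
    by move=> x xU; rewrite -{1}(gU x xU) -comp_lfunE -/(mul g' g) g'g id_lfunE.
  - by move=> g [].
  - move=> g g' x Gg Gg' gg' [[Nx xU] Gx].
    have Gk : Gam_j (mul g (mul x g')) by apply: (GM) => //; apply: (GM).
    split=> //; split; first by case: Gk.
    move=> v vU; rewrite !comp_lfunE /= xU ?stabU //; last by case: Gg'.
    by rewrite -comp_lfunE -/(mul g g') gg' id_lfunE.
split=> //; apply: (quotient_free_action _ _ _ GU_normal).
- exact: comp_lfunA.
- exact: comp_lfun1l.
- exact: comp_lfun1r.
- have [actO act1 actM] := act.
  split=> [g X Gg [OX XU]|X [OX _]|g g' X Gg Gg' [OX _]].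
  + split; first exact: actO.
    have [_ _ GV] := Gj; have [g' Gg' [gg' _]] := GV _ Gg.
    rewrite span_act_tuple XU; apply/eqP; rewrite eqEsubv; apply/andP; split.
      by apply/subvP => _ /memv_imgP[v vU ->]; apply: stabU => //; case: Gg.
    apply/subvP => v vU; apply/memv_imgP; exists (g' v).
      by apply: stabU => //; case: Gg'.
    by rewrite -comp_lfunE -/(mul g g') gg' id_lfunE.
  + exact: act1.
  + exact: actM.
- move=> g X Gg [_ XU]; rewrite act_tuple_fixP XU; split=> [gU|[[_ gU] _] //].
  by split=> //; split=> //; case: Gg.
Qed.
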